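(* Let $D$ be a finite simple digraph with at least one vertex. Then $F(D)=0$ if and only if $D$ is a directed cycle.
   Context: A finite simple digraph $D=(V,A)$ has finite nonempty vertex set $V$ and arc set $A$ consisting of ordered pairs of distinct vertices (no loops, no parallel arcs; both $(u,v)$ and $(v,u)$ may be present). $N_D^+(v)=\{u:(v,u)\in A\}$. Zero forcing: for $S\subseteq V$ let $B^0(S)=S$ and $B^{i+1}(S)=B^i(S)\cup\{w:\{w\}=N_D^+(v)\setminus B^i(S)\text{ for some }v\in B^i(S)\}$. $S$ is a zero forcing set (ZFS) if $B^t(S)=V$ for some $t\ge 0$, and a failed zero forcing set (FZFS) otherwise. The failed zero forcing number $F(D)$ is the largest cardinality of an FZFS of $D$. $D$ is a directed cycle if its vertices can be labeled $v_1,\dots,v_n$ so that its arcs are exactly $(v_1,v_2),(v_2,v_3),\dots,(v_{n-1},v_n),(v_n,v_1)$, where $n\ge 2$ (for $n=2$ this is the digraph with both arcs between two vertices); by convention the digraph with a single vertex and no arcs also counts as a directed cycle. *)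

(* Defs.v *)
From mathcomp Require Import all_boot.
From mathcomp Require Import boolp.

Set Implicit Arguments.
Unset Strict Implicit.
Unset Printing Implicit Defensive.

(* A finite simple digraph is a finType T of vertices with an irreflexive
   relation e : rel T, where [e u v] means that (u, v) is an arc. *)

Definition out_nbrs (T : finType) (e : rel T) (v : T) : {set T} :=
  [set u | e v u].

Definition force_step (T : finType) (e : rel T) (B : {set T}) : {set T} :=
  B :|: [set w | [exists v in B, [set w] == out_nbrs e v :\: B]].

Definition forced (T : finType) (e : rel T) (S : {set T}) (t : nat) : {set T} :=
  iter t (force_step e) S.

Definition zero_forcing (T : finType) (e : rel T) (S : {set T}) : Prop :=
  exists t : nat, forced e S t = [set: T].

Definition failed_zero_forcing (T : finType) (e : rel T) (S : {set T}) : Prop :=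
  ~ zero_forcing e S.

(* If T is nonempty then set0 is failed, so the maximum below ranges over a
   nonempty family and its default value 0 plays no role. *)
Definition failed_zero_forcing_number (T : finType) (e : rel T) : nat :=
  \max_(S : {set T} | `[< failed_zero_forcing e S >]) #|S|.

(* In the second case the order of the cycle is n.+2, and [ordS i] is the
   successor of i modulo n.+2. *)
Definition directed_cycle (T : finType) (e : rel T) : Prop :=
  (#|T| = 1 /\ forall u v : T, ~~ e u v) \/
  (exists (n : nat) (f : 'I_n.+2 -> T),
     bijective f /\ forall i j : 'I_n.+2, e (f i) (f j) = (j == ordS i)).

(* Main.v *)
Require Import Defs.
From mathcomp Require Import all_boot.
From mathcomp Require Import boolp.

(** [F(D) = 0] means that every nonempty set forces, so a nonempty set on which
    no force is possible must be the whole vertex set. If there are at least two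
    vertices, applying this to singletons shows that every out-degree is 1, so
    the arcs form the graph of a map [s]; applying it to orbits of [s], which
    are closed under out-neighbours, shows that every orbit is everything, hence
    [s] is a single cycle. Conversely, on a directed cycle a blue vertex makes
    its successor blue at each step. *)

Lemma failed_zero_forcing_number_eq0 (T : finType) (e : rel T) :
  failed_zero_forcing_number e = 0 <->
  forall S : {set T}, S != set0 -> zero_forcing e S.
Proof.
split=> [F0 S S0 | zf].
  case: (pselect (zero_forcing e S)) => // /asboolP fS.
  have : #|S| <= failed_zero_forcing_number e.
    exact: (@leq_bigmax_cond _ _ (fun S : {set T} => #|S|) S fS).
  by rewrite F0 leqn0 cards_eq0 (negPf S0).
apply/eqP; rewrite -leqn0; apply/bigmax_leqP => S /asboolP fS.
by rewrite leqn0 cards_eq0; case: (boolP (S == set0)) => // /zf.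
Qed.

Lemma stalled_zero_forcing (T : finType) (e : rel T) (S : {set T}) :
  force_step e S = S -> zero_forcing e S -> S = setT.
Proof. by move=> stS [t <-]; rewrite /forced iter_fix. Qed.

(** A vertex of [S] has no white out-neighbour, so it has nothing to force. *)
Lemma out_closed_stalled (T : finType) (e : rel T) (S : {set T}) :
  (forall v, v \in S -> out_nbrs e v \subset S) -> force_step e S = S.
Proof.
move=> clS; apply/setUidPl/subsetP => w; rewrite inE.
case/existsP => v /andP[/clS]; rewrite -setD_eq0 => /eqP -> /eqP/setP/(_ w).
by rewrite !inE eqxx.
Qed.

(** Without loops all out-neighbours of [v] are white, so [v] can force only if its out-degree is
    1. *)
Lemma singleton_stalled (T : finType) (e : rel T) (v : T) :
  irreflexive e -> (forall w, out_nbrs e v != [set w]) ->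
  force_step e [set v] = [set v].
Proof.
move=> e_irr outv; apply/setUidPl/subsetP => w; rewrite inE.
case/existsP => u /andP[/set1P ->]; rewrite (setDidPl _); last first.
  by rewrite disjoint_sym disjoints1 inE e_irr.
by rewrite eq_sym (negPf (outv w)).
Qed.

Lemma transitive_fun_directed_cycle (T : finType) (e : rel T) (s : T -> T) :
  1 < #|T| -> (forall u v, e u v = (v == s u)) ->
  (forall u v, fconnect s u v) -> directed_cycle e.
Proof.
move=> T_gt1 es conn; right.
(* Some iterate of [s] takes [s v] back to [v], so [v] is [s] of an iterate of [v]. Injectivity then
   follows by finiteness. *)
have s_surj v : v \in codom s.
  have /iter_findex <- := conn (s v) v.
  by rewrite -iterSr iterS codom_f.
have s_inj : injective s.
  apply/injectiveP/card_uniqP; rewrite size_codom.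
  by apply: eq_card => v; rewrite s_surj.
have [x _] : exists x : T, x \in T by apply/card_gt0P/ltnW.
have ordx : order s x = #|T| by apply: eq_card => v; rewrite inE conn.
case cardT: #|T| T_gt1 => [|[|n]] // _; rewrite cardT in ordx.
exists n, (fun i : 'I_n.+2 => iter i s x).
have f_bij : bijective (fun i : 'I_n.+2 => iter i s x).
  exists (fun v => inord (findex s x v)) => [i | v].
    by apply: val_inj; rewrite /= findex_iter ?inord_val // ordx.
  by rewrite inordK ?iter_findex // -ordx findex_max.
split=> // i j; rewrite es.
have -> : s (iter i s x) = iter (ordS i) s x.
  rewrite -iterS -[nat_of_ord (ordS i)]/(i.+1 %% n.+2).
  (* The last index wraps around to 0: the orbit of [x] has length [n.+2], so [s] returns to [x]. *)
  have [->|i_ne] := eqVneq (i : nat) n.+1.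
    by rewrite modnn -ordx iter_order.
  by rewrite modn_small // ltnS ltn_neqAle i_ne -ltnS ltn_ord.
by rewrite (bij_eq f_bij).
Qed.

Lemma val_iter_ordS (n : nat) (i : 'I_n.+1) (k : nat) :
  iter k (@ordS n.+1) i = (i + k) %% n.+1 :> nat.
Proof.
elim: k => [|k IHk] /=; first by rewrite addn0 modn_small.
by rewrite IHk -addn1 modnDml addn1 addnS.
Qed.

Lemma forced_mono (T : finType) (e : rel T) (S : {set T}) (t k : nat) :
  forced e S t \subset forced e S (k + t).
Proof.
by elim: k => // k IHk; apply: subset_trans IHk _; rewrite addSn; apply: subsetUl.
Qed.

Lemma directed_cycle_zero_forcing (T : finType) (e : rel T) (n : nat)
    (f : 'I_n.+2 -> T) (S : {set T}) :
  bijective f -> (forall i j, e (f i) (f j) = (j == ordS i)) ->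
  S != set0 -> zero_forcing e S.
Proof.
move=> f_bij ef /set0Pn[v]; have [g gK fK] := f_bij.
rewrite -(fK v); move: (g v) => i iS.
have outf j : out_nbrs e (f j) = [set f (ordS j)].
  by apply/setP => w; rewrite -(fK w) !inE ef (bij_eq f_bij).
have blue k : f (iter k (@ordS _) i) \in forced e S k.
  elim: k => // k; rewrite /= -/(forced e S k).
  move: (iter k _ i) (forced e S k) => j B jB.
  (* If the successor of [f j] is still white, it is the only out-neighbour of [f j], hence forced
     now. *)
  rewrite !inE; case: (boolP (_ \in B)) => //= jSB.
  apply/existsP; exists (f j); rewrite jB outf eq_sym.
  by apply/eqP/setDidPl; rewrite disjoints1.
(* A crude time bound. Index [j] is reached from [i] in [k] steps, as [i + k = j + n.+2]; adding
   [n.+2] keeps the subtraction of [i] from truncating. *)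
exists (n.+2 + n.+2); apply/setP => w; rewrite in_setT -(fK w); move: (g w) => j.
pose k := j + (n.+2 - i).
have -> : j = iter k (@ordS _) i.
  apply: val_inj; rewrite /= val_iter_ordS addnCA subnKC 1?ltnW //.
  by rewrite modnDr modn_small.
have k_le : k <= n.+2 + n.+2 by rewrite leq_add ?leq_subr // ltnW.
by rewrite -(subnK k_le); apply: (subsetP (forced_mono _ _ _ _ _)).
Qed.

Theorem theorem2p4 (T : finType) (e : rel T)
  (e_irr : irreflexive e) (T_gt0 : 0 < #|T|) :
  failed_zero_forcing_number e = 0 <-> directed_cycle e.
Proof.
rewrite failed_zero_forcing_number_eq0; split=> [zf | ]; last first.
  case=> [[T1 _] S S0 | [n [f [f_bij ef]]] S S0].
    exists 0; apply/eqP; rewrite eqEcard subsetT cardsT T1 card_gt0.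
    exact: S0.
  exact: directed_cycle_zero_forcing f_bij ef S0.
have [T_le1 | T_gt1] := leqP #|T| 1.
  left; split; first by apply/eqP; rewrite eqn_leq T_le1.
  by move=> u v; rewrite (fintype_le1P T_le1 u v) e_irr.
(* Otherwise [[set v]] is stalled yet forcing, so it is the whole vertex set, against [T_gt1]. *)
have outP v : exists w, out_nbrs e v == [set w].
  apply/existsP; apply: contraT => /existsPn outv.
  have vT : [set v] = setT.
    apply: (stalled_zero_forcing _ _ _ (singleton_stalled _ _ _ e_irr outv)).
    by apply: zf; apply/set0Pn; exists v; rewrite set11.
  by move: T_gt1; rewrite -cardsT -vT cards1.
pose s v := xchoose (outP v).
have es u v : e u v = (v == s u).
  by have /eqP/setP/(_ v) := xchooseP (outP u); rewrite !inE.
apply: (transitive_fun_directed_cycle _ _ s T_gt1 es) => u v.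
(* The forward orbit of [u] is nonempty and closed under out-neighbours, hence stalled. *)
have orbT : [set w | fconnect s u w] = setT.
  apply: (stalled_zero_forcing T e); last first.
    by apply: zf; apply/set0Pn; exists u; rewrite inE connect0.
  apply: out_closed_stalled => w; rewrite inE => uw.
  apply/subsetP => x; rewrite !inE es => /eqP ->.
  exact: connect_trans uw (fconnect1 _ _).
by have /setP/(_ v) := orbT; rewrite !inE.
Qed.
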